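(* Let $X$ be a compact Hausdorff space, $N\ge1$, and $\phi_1,\dots,\phi_m$ real-valued continuous functions on $X$. For $d\ge1$ let $\mathcal C(X,d,\boldsymbol\phi)$ be the set of $d\times d$ matrix-valued Borel measures $\mu$ on $X$ with $\mu(\Delta)\ge0$ for all Borel $\Delta$, $\mu(X)=I_d$, and $\int_X\phi_r\,d\mu=0$ for $r=1,\dots,m$. Suppose $\mu=\sum_{k=1}^n\mu_kL_k$, where (i) each $\mu_k$ is a positive scalar measure which is an extreme point of $\mathcal C(X,1,\boldsymbol\phi)$, and the supports $\operatorname{supp}\mu_k$, $k=1,\dots,n$, are pairwise disjoint; (ii) the $N\times N$ matrices $L_k$ satisfy $L_k\ge0$ for each $k$ and $\sum_{k=1}^nL_k=I_N$; (iii) the family of subspaces $\{\operatorname{Ran}L_k : k=1,\dots,n\}$ of $\mathbb C^N$ is weakly independent. Then $\mu$ is an extreme point of $\mathcal C(X,N,\boldsymbol\phi)$.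
   Context: An operator $T$ on $\mathbb C^N$ lives on a subspace $\mathcal M$ if $T=TP_{\mathcal M}=P_{\mathcal M}T$, with $P_{\mathcal M}$ the orthogonal projection onto $\mathcal M$. A family of subspaces $\{\mathcal M_1,\dots,\mathcal M_n\}$ of $\mathbb C^N$ is weakly independent if whenever $T_1,\dots,T_n$ are linear operators on $\mathbb C^N$ with $T_j$ living on $\mathcal M_j$ for each $j$ and $\sum_{j=1}^nT_j=0$, it follows that $T_j=0$ for all $j$. *)

(* Defs.v *)
From HB Require Import structures.
From mathcomp Require Import all_boot all_order all_algebra.
From mathcomp Require Import all_classical all_reals all_analysis.
From mathcomp Require Import complex.

Set Implicit Arguments.
Unset Strict Implicit.
Unset Printing Implicit Defensive.

Import Order.TTheory GRing.Theory Num.Theory.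
Import numFieldNormedType.Exports.
Local Open Scope classical_set_scope.
Local Open Scope ring_scope.

Definition Borel (X : ptopologicalType) := g_sigma_algebraType (@open X).

Definition adjmx (R : realType) (p q : nat) (A : 'M[R[i]]_(p, q)) : 'M[R[i]]_(q, p) :=
  (map_mx Num.conj A)^T.

Definition psdmx (R : realType) (d : nat) (A : 'M[R[i]]_d) : Prop :=
  forall v : 'cV[R[i]]_d, 0 <= (adjmx v *m A *m v) 0 0.

Definition evec (R : realType) (d : nat) (j : 'I_d) : 'cV[R[i]]_d := delta_mx j 0.

Section MatrixMeasures.
Context (R : realType) (X : ptopologicalType).
Local Notation T := (Borel X).

Definition mxmeasure (d : nat) (mu : set T -> 'M[R[i]]_d) : Prop :=
  forall F : nat -> set T, (forall k, measurable (F k)) -> trivIset setT F ->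
  forall i j : 'I_d,
    ((fun n : nat => \sum_(k < n) (complex.Re (mu (F k) i j) : R)) @ \oo
       --> (complex.Re (mu (\bigcup_k F k) i j) : R)) /\
    ((fun n : nat => \sum_(k < n) (complex.Im (mu (F k) i j) : R)) @ \oo
       --> (complex.Im (mu (\bigcup_k F k) i j) : R)).

Definition qform (d : nat) (mu : set T -> 'M[R[i]]_d) (v : 'cV[R[i]]_d)
  : set T -> \bar R :=
  fun A => (complex.Re ((adjmx v *m mu A *m v) 0 0))%:E.

Definition sint (q : set T -> \bar R) (f : X -> R) : R :=
  fine (integral q setT (fun x : T => (f x)%:E)).

(* matrix integral  \int_X f dmu  of a positive matrix measure, entry (i,j)
   recovered from the scalar measures v^* mu v by polarization:
   mu_ij = 1/4 sum_{k<4} 'i^k (e_j + 'i^k e_i)^* mu (e_j + 'i^k e_i). *)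
Definition mx_int (d : nat) (mu : set T -> 'M[R[i]]_d) (f : X -> R) : 'M[R[i]]_d :=
  \matrix_(i, j) (4%:R^-1 * \sum_(k < 4)
      ('i ^+ k * (sint (qform mu (evec R j + 'i ^+ k *: evec R i)) f)%:C%C)).

Definition mxC (d m : nat) (phi : 'I_m -> X -> R) (mu : set T -> 'M[R[i]]_d) : Prop :=
  [/\ mxmeasure mu,
      (forall A, measurable A -> psdmx (mu A)),
      mu setT = 1%:M &
      (forall r, mx_int mu (phi r) = 0)].

(* extreme point of a set P of matrix measures (measures identified when
   they agree on all Borel sets) *)
Definition extreme_pt (d : nat) (P : (set T -> 'M[R[i]]_d) -> Prop)
  (mu : set T -> 'M[R[i]]_d) : Prop :=
  P mu /\
  forall (nu1 nu2 : set T -> 'M[R[i]]_d) (t : R), 0 < t < 1 -> P nu1 -> P nu2 ->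
    (forall A, measurable A -> mu A = t%:C%C *: nu1 A + (1 - t)%:C%C *: nu2 A) ->
    forall A, measurable A -> nu1 A = mu A /\ nu2 A = mu A.

Definition supp (mu : set T -> 'M[R[i]]_1) : set X :=
  [set x : X | forall U : set X, open U -> U x -> mu U 0 0 != 0].

End MatrixMeasures.

Section WeakIndependence.
Context (R : realType) (N : nat).

(* column space (range) of A as a row-space (mxalgebra) object *)
Definition Ran (A : 'M[R[i]]_N) : 'M[R[i]]_N := A^T.

Definition orthproj (M P : 'M[R[i]]_N) : Prop :=
  [/\ P *m P = P, adjmx P = P & (Ran P == Ran M)%MS].

Definition lives_on (Top M : 'M[R[i]]_N) : Prop :=
  exists P, [/\ orthproj M P, Top = Top *m P & Top = P *m Top].

Definition weakly_indep (n : nat) (M : 'I_n -> 'M[R[i]]_N) : Prop :=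
  forall Top : 'I_n -> 'M[R[i]]_N, (forall j, lives_on (Top j) (M j)) ->
    \sum_(j < n) Top j = 0 -> forall j, Top j = 0.

End WeakIndependence.

(* Main.v *)
(* The pairwise disjoint supports are compact, so they have disjoint open
   neighbourhoods E_k, and mu_k is carried by E_k because its complement is a
   compact set covered by null open sets.  Let mu = t nu + (1 - t) nu'.  On E_k
   the measure t nu is dominated by mu_k L_k, so nu(E_k) and the integral of
   phi_r over E_k against nu live on Ran L_k.  Summing over k gives I = sum L_k
   and 0 respectively, so weak independence yields nu(E_k) = L_k and vanishing
   integrals over each E_k.  For every vector v, the scalar measures v^* nu v
   and v^* nu' v restricted to E_k thus have mass v^* L_k v and satisfy the
   constraints, and t, 1 - t combine them into (v^* L_k v) mu_k; extremality of
   mu_k gives v^* nu v = (v^* L_k v) mu_k on E_k. *)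

Require Import Defs.
From HB Require Import structures.
From mathcomp Require Import all_boot all_order all_algebra.
From mathcomp Require Import all_classical all_reals all_analysis.
From mathcomp Require Import complex.
From mathcomp Require Import measurable_realfun ring lra.

Import Order.TTheory GRing.Theory Num.Theory.
Import numFieldNormedType.Exports.
Local Open Scope classical_set_scope.
Local Open Scope ring_scope.

Set Implicit Arguments.
Unset Strict Implicit.
Unset Printing Implicit Defensive.

(** * Sesquilinear forms, polarization and positive semidefinite matrices over the complex
    numbers *)

Section QuadraticForms.
Context (R : realType).
Local Notation C := R[i].

Definition sform (d : nat) (A : 'M[C]_d) (u v : 'cV[C]_d) : C :=
  (adjmx u *m A *m v) 0 0.

Definition qf (d : nat) (A : 'M[C]_d) (v : 'cV[C]_d) : C := sform A v v.

Lemma adjmxK p q (A : 'M[C]_(p, q)) : adjmx (adjmx A) = A.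
Proof. by apply/matrixP => i j; rewrite !mxE conjCK. Qed.

Lemma adjmxM p q r (A : 'M[C]_(p, q)) (B : 'M[C]_(q, r)) :
  adjmx (A *m B) = adjmx B *m adjmx A.
Proof. by rewrite /adjmx map_mxM trmx_mul. Qed.

Lemma adjmxD p q (A B : 'M[C]_(p, q)) : adjmx (A + B) = adjmx A + adjmx B.
Proof. by apply/matrixP => i j; rewrite !mxE rmorphD. Qed.

Lemma adjmxZ p q a (A : 'M[C]_(p, q)) : adjmx (a *: A) = a^* *: adjmx A.
Proof. by apply/matrixP => i j; rewrite !mxE rmorphM. Qed.

Lemma sformE d (A : 'M[C]_d) u v :
  sform A u v = \sum_i \sum_j (u i 0)^* * v j 0 * A i j.
Proof.
rewrite /sform mxE exchange_big; apply: eq_bigr => j _ /=.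
rewrite mxE mulr_suml; apply: eq_bigr => i _.
by rewrite !mxE mulrAC.
Qed.

Lemma sformDl d (A : 'M[C]_d) u u' v :
  sform A (u + u') v = sform A u v + sform A u' v.
Proof. by rewrite /sform adjmxD !mulmxDl mxE. Qed.

Lemma sformDr d (A : 'M[C]_d) u v v' :
  sform A u (v + v') = sform A u v + sform A u v'.
Proof. by rewrite /sform mulmxDr mxE. Qed.

Lemma sformZl d (A : 'M[C]_d) a u v : sform A (a *: u) v = a^* * sform A u v.
Proof. by rewrite /sform adjmxZ -!scalemxAl mxE. Qed.

Lemma sformZr d (A : 'M[C]_d) a u v : sform A u (a *: v) = a * sform A u v.
Proof. by rewrite /sform -scalemxAr mxE. Qed.

Lemma sform_evec d (A : 'M[C]_d) i j : sform A (evec R i) (evec R j) = A i j.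
Proof.
rewrite sformE (bigD1 i) //= (bigD1 j) //= !mxE !eqxx /= rmorph1 !mul1r.
rewrite big1 ?addr0 => [|k /negPf kj]; last by rewrite !mxE kj mulr0 mul0r.
rewrite big1 ?addr0 // => k /negPf ki.
by rewrite big1 // => l _; rewrite !mxE ki rmorph0 !mul0r.
Qed.

Lemma sum_powers_i (F : C -> C) :
  \sum_(k < 4) ('i ^+ k * F ('i ^+ k)) =
  F 1 + 'i * F 'i - F (-1) - 'i * F (- 'i).
Proof.
have i2 : 'i ^+ 2 = -1 :> C by exact: sqrCi.
have i3 : 'i ^+ 3 = - 'i :> C by rewrite exprS i2 mulrN1.
have sum4 (G : nat -> C) : \sum_(k < 4) G k = G 0%N + G 1%N + G 2%N + G 3%N.
  by rewrite !big_ord_recr big_ord0 /= add0r.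
rewrite (sum4 (fun k => 'i ^+ k * F ('i ^+ k))).
by rewrite expr0 expr1 i2 i3 mul1r mulN1r mulNr.
Qed.

Lemma qfDZ d (A : 'M[C]_d) z u v : qf A (v + z *: u) =
  qf A v + z * sform A v u + z^* * (sform A u v + z * qf A u).
Proof.
by rewrite /qf sformDl (sformDr A v) (sformDr A (z *: u)) !sformZl !sformZr
  mulrDr.
Qed.

(** Expanding with [z = 'i ^+ k], only the coefficient [z * z^* = 1] of [sform A u v] survives
    summation; the powers [z] and [z ^+ 2] sum to zero. At basis vectors this is the formula by
    which [mx_int] recovers entries. *)
Lemma sform_polarization d (A : 'M[C]_d) u v :
  sform A u v = 4%:R^-1 * \sum_(k < 4) ('i ^+ k * qf A (v + 'i ^+ k *: u)).
Proof.
have ii : 'i * 'i = -1 :> C by rewrite -expr2; exact: sqrCi.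
have conjNi : (- 'i)^* = 'i :> C by rewrite rmorphN /= conjCi opprK.
rewrite (sum_powers_i (fun z => qf A (v + z *: u))) !qfDZ.
rewrite rmorphN rmorph1 conjNi conjCi.
move: (sform A u v) (sform A v u) (qf A u) (qf A v) => a b c e.
apply: (mulfI (x := 4%:R)); first by rewrite pnatr_eq0.
rewrite mulrA divff ?pnatr_eq0 // mul1r.
move: ('i) ii {conjNi} => I ii.
ring: ii.
Qed.

Lemma qfB d (A B : 'M[C]_d) v : qf (A - B) v = qf A v - qf B v.
Proof. by rewrite /qf /sform mulmxBr mulmxBl !mxE. Qed.

Lemma qfZ d a (A : 'M[C]_d) v : qf (a *: A) v = a * qf A v.
Proof. by rewrite /qf /sform -scalemxAr -scalemxAl mxE. Qed.

Lemma qfD d (A B : 'M[C]_d) v : qf (A + B) v = qf A v + qf B v.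
Proof. by rewrite /qf /sform mulmxDr mulmxDl !mxE. Qed.

Lemma qf0 d v : qf (0 : 'M[C]_d) v = 0.
Proof. by rewrite /qf /sform mulmx0 mul0mx mxE. Qed.

Lemma qf_sum d (I : Type) (r : seq I) (P : pred I) (F : I -> 'M[C]_d) v :
  qf (\sum_(i <- r | P i) F i) v = \sum_(i <- r | P i) qf (F i) v.
Proof.
by apply: (big_morph (fun A => qf A v)) => [A B|]; [exact: qfD|exact: qf0].
Qed.

Lemma qf_inj d (A B : 'M[C]_d) : (forall v, qf A v = qf B v) -> A = B.
Proof.
move=> AB; apply/matrixP => i j; rewrite -!sform_evec !sform_polarization.
by congr (_ * _); apply: eq_bigr => k _; rewrite AB.
Qed.

Lemma qf_mulmx d (A P : 'M[C]_d) v :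
  qf A (P *m v) = qf (adjmx P *m A *m P) v.
Proof. by rewrite /qf /sform adjmxM !mulmxA. Qed.

Lemma complex_eqP (x y : C) :
  complex.Re x = complex.Re y -> complex.Im x = complex.Im y -> x = y.
Proof. by case: x y => [a b] [c e] /= -> ->. Qed.

Lemma psdmx_qf d (A : 'M[C]_d) v :
  psdmx A -> qf A v = (complex.Re (qf A v))%:C%C.
Proof.
move=> /(_ v); rewrite -/(sform A v v) -/(qf A v).
by case: (qf A v) => a b; rewrite lecE /= => /andP[/eqP -> _].
Qed.

Lemma psdmx_ge0 d (A : 'M[C]_d) v : psdmx A -> 0 <= complex.Re (qf A v).
Proof.
move=> /(_ v); rewrite -/(sform A v v) -/(qf A v).
by case: (qf A v) => a b; rewrite lecE /= => /andP[].
Qed.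

Lemma psdmx_Re_inj d (A B : 'M[C]_d) : psdmx A -> psdmx B ->
  (forall v, complex.Re (qf A v) = complex.Re (qf B v)) -> A = B.
Proof.
by move=> pA pB AB; apply: qf_inj => v; rewrite psdmx_qf // AB -psdmx_qf.
Qed.

(* [s |-> qf A (v + s w)] is affine and nonnegative on the real line, hence
   constant. *)
Lemma psdmx_qfDker d (A : 'M[C]_d) v w : psdmx A -> qf A w = 0 ->
  qf A (v + w) = qf A v.
Proof.
move=> psdA Aw0.
pose z := sform A v w + sform A w v.
have E (s : R) : qf A (v + s%:C%C *: w) = qf A v + s%:C%C * z.
  rewrite qfDZ Aw0 mulr0 addr0 conj_Creal ?complex_real // /z mulrDr.
  by rewrite addrA.
have E1 : qf A (v + w) = qf A v + z.
  by have := E 1; rewrite rmorph1 scale1r mul1r.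
suff z0 : z = 0 by rewrite E1 z0 addr0.
have H s : 0 <= qf A v + s%:C%C * z by rewrite -E; exact: psdA.
move: H; rewrite (psdmx_qf _ psdA); case: z {E E1} => a b.
set K := complex.Re _ => H.
have {}H s : 0 = s * b /\ 0 <= K + s * a.
  have := H s; rewrite lecE /= !mul0r !subr0 !addr0 add0r.
  by move=> /andP[/eqP ->].
have b0 : b = 0 by have [+ _] := H 1; rewrite mul1r.
have a0 : a = 0.
  apply/eqP; apply/negPn/negP => a0.
  (* This value of [s] makes [K + s * a] equal to [-1]. *)
  have [_] := H (- (K + 1) / a); rewrite divfK //.
  lra.
by rewrite a0 b0.
Qed.

End QuadraticForms.

(** * Orthogonal projections onto ranges and a criterion for living on a range *)

Section OrthogonalProjection.
Context (R : realType).
Local Notation C := R[i].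

(** The diagonal entries of [A^* A] are the sums of squared moduli over the columns of [A]. *)
Lemma adjmx_mul_eq0 p q (A : 'M[C]_(p, q)) : adjmx A *m A = 0 -> A = 0.
Proof.
move=> AA0; apply/matrixP => i j; rewrite mxE.
have := congr1 (fun B : 'M[C]_q => B j j) AA0; rewrite !mxE => /eqP.
rewrite psumr_eq0 => [|k _]; last first.
  by rewrite !mxE mulrC; exact: mul_conjC_ge0.
move=> /allP/(_ i (mem_index_enum _))/implyP/(_ isT).
by rewrite !mxE mulf_eq0 conjC_eq0 orbb => /eqP.
Qed.

(** Taking the adjoint conjugates the quadratic form, which is real here and determines the
    matrix. *)
Lemma psdmx_adj d (A : 'M[C]_d) : psdmx A -> adjmx A = A.
Proof.
move=> psdA; apply: qf_inj => v.
have -> : qf (adjmx A) v = (qf A v)^*.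
  transitivity (adjmx (adjmx v *m A *m v) 0 0); last by rewrite mxE mxE.
  by rewrite !adjmxM adjmxK mulmxA.
by rewrite psdmx_qf // conj_Creal // complex_real.
Qed.

(** With the columns of [D] a basis of the range of [M], take [P = D (D^* D)^-1 D^*]. The Gram
    matrix [D^* D] is invertible: [v D^* D = 0] forces [D v^* = 0], hence [v = 0]. *)
Lemma exists_orthproj d (M : 'M[C]_d) : exists2 P, orthproj M P & P *m M = M.
Proof.
pose B := row_base M^T; pose D := B^T.
have eqB : (B :=: M^T)%MS := eq_row_base _.
pose G := adjmx D *m D.
have Gu : G \in unitmx.
  rewrite -row_free_unit; apply: inj_row_free => v vG0.
  have : D *m adjmx v = 0.
    apply: adjmx_mul_eq0; rewrite adjmxM adjmxK.
    by rewrite !mulmxA -(mulmxA v) vG0 mul0mx.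
  move=> /(congr1 trmx); rewrite trmx_mul (trmxK B) trmx0 => /eqP.
  rewrite mulmx_free_eq0 ?row_base_free // => /eqP/(congr1 trmx).
  rewrite trmxK trmx0 => /(congr1 (@adjmx _ _ _)).
  by rewrite adjmxK => ->; apply/matrixP => i j; rewrite !mxE rmorph0.
have adjG : adjmx G = G by rewrite adjmxM adjmxK.
have adjGV : adjmx (invmx G) = invmx G.
  by rewrite -[in RHS]adjG /adjmx map_invmx trmx_inv.
pose P := D *m invmx G *m adjmx D.
have PD : P *m D = D by rewrite -[P *m D]mulmxA mulmxKV.
have PM : P *m M = M.
  have /submxP[K MK] : (M^T <= B)%MS by rewrite eqB.
  by rewrite -[M]trmxK MK trmx_mul mulmxA PD.
exists P => //; split.
- by rewrite {2}/P !mulmxA PD.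
- by rewrite !adjmxM adjmxK adjGV mulmxA.
- apply/andP; split; rewrite /Ran.
    rewrite /P !trmx_mul (trmxK B) mulmxA.
    by apply: submx_trans (submxMl _ _) _; rewrite eqB.
  by rewrite -{1}PM trmx_mul submxMl.
Qed.

(** Let [P] project onto the range of [L]. Every [v] is [P v] plus a vector killed by [L], so
    [qf M v = qf M (P v)], that is, [M = P M P]. *)
Lemma lives_on_qf d (L M : 'M[C]_d) : psdmx L ->
  (forall v w, qf L w = 0 -> qf M (v + w) = qf M v) -> lives_on M L.
Proof.
move=> psdL invM; have [P oP PL] := exists_orthproj L.
have [PP adjP _] := oP; exists P.
have LP : L *m P = L.
  by rewrite -{1}(psdmx_adj psdL) -{1}adjP -adjmxM PL psdmx_adj.
have MP : M = P *m M *m P.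
  apply: qf_inj => v; rewrite -[X in X *m M]adjP -qf_mulmx.
  rewrite -{1}(subrKC (P *m v) v) invM //.
  by rewrite /qf /sform -mulmxA mulmxBr mulmxA LP subrr mulmx0 mxE.
by split => //; rewrite {1}MP [in RHS]MP -!mulmxA ?PP // !mulmxA PP.
Qed.

End OrthogonalProjection.

(** * Finite positive measures as real-valued set functions *)

Section FiniteMeasures.
Context d (T : measurableType d) (R : realType).
Implicit Types q : set T -> R.

(* The values of a finite measure outside the sigma-algebra are unconstrained,
   as they are for the matrix measures of the statement. *)
Definition fin_meas q : Prop :=
  (forall A, measurable A -> 0 <= q A) /\
  (forall F : nat -> set T, (forall k, measurable (F k)) -> trivIset setT F ->
    (fun n => \sum_(k < n) q (F k)) @ \oo --> q (\bigcup_k F k)).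

(** For the constant sequence [set0] the partial sums converge, so their increments, all equal to
    [q set0], tend to zero. *)
Lemma fin_meas0 q : fin_meas q -> q set0 = 0.
Proof.
move=> [_ /(_ (fun=> set0) (fun=> measurable0))].
rewrite bigcup0 // => /(_ (@trivIset_set0 _ _ _)) cq.
have cq1 : (fun n => \sum_(k < n.+1) q set0 - \sum_(k < n) q set0) @ \oo
    --> q set0 - q set0.
  by apply: cvgB => //; move: cq; rewrite -cvg_shiftS.
have cq2 : (fun n => \sum_(k < n.+1) q set0 - \sum_(k < n) q set0) @ \oo
    --> q set0.
  by under eq_fun do rewrite big_ord_recr /= addrAC subrr add0r; exact: cvg_cst.
by rewrite -(cvg_lim (@Rhausdorff R) cq2) (cvg_lim (@Rhausdorff R) cq1) subrr.
Qed.

(** Resetting the values outside the sigma-algebra to zero yields a bundled measure, to which the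
    library results apply. *)
Lemma fin_meas_ex q : fin_meas q ->
  exists mu : {measure set T -> \bar R},
    forall A, measurable A -> mu A = (q A)%:E.
Proof.
move=> fq.
pose mu A : \bar R := if pselect (measurable A) then (q A)%:E else 0%E.
have muE A : measurable A -> mu A = (q A)%:E by rewrite /mu; case: pselect.
have mu0 : mu set0 = 0%E by rewrite muE // fin_meas0.
have mu_ge0 A : (0 <= mu A)%E.
  by rewrite /mu; case: pselect => // mA; rewrite lee_fin fq.1.
have mu_sadd : semi_sigma_additive mu.
  move=> F mF tF mUF; rewrite muE //.
  have -> : (fun n => (\sum_(0 <= i < n) mu (F i))%E) =
      EFin \o (fun n => \sum_(k < n) q (F k)).
    apply/funext => n /=; rewrite -sumEFin big_mkord.
    by apply: eq_bigr => k _; exact: muE.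
  by apply: cvg_EFin; [exact: nearW|exact: fq.2].
pose HM := isMeasure.Build _ T R mu mu0 mu_ge0 mu_sadd.
pose M : {measure set T -> \bar R} := HB.pack mu HM.
by exists M.
Qed.

Lemma fin_measD q1 q2 : fin_meas q1 -> fin_meas q2 ->
  fin_meas (fun A => q1 A + q2 A).
Proof.
move=> [p1 s1] [p2 s2]; split=> [A mA|F mF tF].
  by rewrite addr_ge0 ?p1 ?p2.
by under eq_fun do rewrite big_split /=; apply: cvgD; [exact: s1|exact: s2].
Qed.

Lemma fin_measZ c q : 0 <= c -> fin_meas q -> fin_meas (fun A => c * q A).
Proof.
move=> c0 [p s]; split=> [A mA|F mF tF]; first by rewrite mulr_ge0 ?p.
by under eq_fun do rewrite -mulr_sumr; apply: cvgMr; exact: s.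
Qed.

Lemma fin_meas_cst0 : fin_meas (fun=> 0).
Proof.
by split=> // F mF tF; under eq_fun do rewrite big1 //; exact: cvg_cst.
Qed.

Lemma fin_meas_sum (I : Type) (r : seq I) (P : pred I) (q : I -> set T -> R) :
  (forall i, P i -> fin_meas (q i)) ->
  fin_meas (fun A => \sum_(i <- r | P i) q i A).
Proof.
move=> fq; elim: r => [|i r IH].
  by under eq_fun do rewrite big_nil; exact: fin_meas_cst0.
under eq_fun do rewrite big_cons; case: (boolP (P i)) => // Pi.
by apply: fin_measD => //; exact: fq.
Qed.

Lemma fin_meas_le q A B : fin_meas q -> measurable A -> measurable B ->
  A `<=` B -> q A <= q B.
Proof.
move=> fq mA mB AB; have [mu muE] := fin_meas_ex fq.
by rewrite -lee_fin -!muE //; apply: le_measure; rewrite ?inE.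
Qed.

Lemma fin_meas_bigsetU n (E : 'I_n -> set T) q A : fin_meas q ->
  (forall k, measurable (E k)) -> trivIset setT E -> measurable A ->
  q A = q (A `\` \big[setU/set0]_(k < n) E k) + \sum_(k < n) q (A `&` E k).
Proof.
move=> fq mE tE mA; have [mu muE] := fin_meas_ex fq.
have mU : measurable (\big[setU/set0]_(k < n) E k).
  by apply: bigsetU_measurable => k _; exact: mE.
apply: EFin_inj; rewrite EFinD -sumEFin -!muE //; last exact: measurableD.
rewrite (measureDI mu mA mU) big_distrr /= measure_semi_additive_ord.
- by congr (_ + _)%E; apply: eq_bigr => k _; apply: muE; exact: measurableI.
- by move=> k; exact: measurableI.
- exact: trivIset_setIl.
- by apply: bigsetU_measurable => k _; exact: measurableI.
Qed.

End FiniteMeasures.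

(** * Linearity of the integral in the measure, for bounded measurable integrands *)

Section IntegralAsFunctionOfMeasure.
Context d (T : measurableType d) (R : realType).
Implicit Types (q : set T -> R) (f : T -> R).
Import HBNNSimple.

(** The integral is built from integrals of simple functions, which evaluate the set function on
    measurable sets only. This covers bare set functions, as used in [sint]. *)
Lemma eq_integral_setfun (mu nu : set T -> \bar R) (g : T -> \bar R) :
  (forall A, measurable A -> mu A = nu A) ->
  integral mu setT g = integral nu setT g.
Proof.
move=> munu; rewrite /integral.
have E (h : {nnsfun T >-> R}) : sintegral mu h = sintegral nu h.
  by apply: eq_fsbigr => r _; rewrite munu.
by congr (ereal_sup _ - ereal_sup _)%E; apply/seteqP; split=> _ [h hg <-];
  exists h.
Qed.

Definition rint q f : R :=
  fine (integral (fun A => (q A)%:E) setT (fun x => (f x)%:E)).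

Definition bounded_measurable f : Prop :=
  measurable_fun setT f /\ exists M : R, forall x, `|f x| <= M.

Lemma eq_rint q1 q2 f : (forall A, measurable A -> q1 A = q2 A) ->
  rint q1 f = rint q2 f.
Proof.
by move=> E; congr fine; apply: eq_integral_setfun => A mA; rewrite E.
Qed.

(** A bounded function is integrable against a finite measure, so [fine] loses no information. *)
Lemma rint_measure q f : fin_meas q -> bounded_measurable f ->
  exists mu : {measure set T -> \bar R},
    [/\ forall A, measurable A -> mu A = (q A)%:E,
        mu.-integrable setT (EFin \o f) &
        (rint q f)%:E = integral mu setT (EFin \o f)].
Proof.
move=> fq [mf [M fM]]; have [mu muE] := fin_meas_ex fq.
have intf : mu.-integrable setT (EFin \o f).
  apply: measurable_bounded_integrable => //; first by rewrite muE ?ltry.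
  exists M; split; first exact: num_real.
  by move=> r Mr x _; exact: le_trans (fM x) (ltW Mr).
exists mu; split => //; rewrite /rint (@eq_integral_setfun _ mu); last first.
  by move=> A mA; rewrite muE.
by rewrite fineK //; exact: integrable_fin_num.
Qed.

Lemma rintD q1 q2 f : fin_meas q1 -> fin_meas q2 -> bounded_measurable f ->
  rint (fun A => q1 A + q2 A) f = rint q1 f + rint q2 f.
Proof.
move=> fq1 fq2 bf.
have [m1 [m1E i1 e1]] := rint_measure fq1 bf.
have [m2 [m2E i2 e2]] := rint_measure fq2 bf.
apply: EFin_inj; rewrite EFinD e1 e2 -integral_measure_add //.
have [m [mE i ->]] := rint_measure (fin_measD fq1 fq2) bf.
apply: eq_measure_integral => A mA _; rewrite mE // EFinD -m1E // -m2E //.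
exact/esym/measure_addE.
Qed.

Lemma rintZ c q f : 0 <= c -> fin_meas q -> bounded_measurable f ->
  rint (fun A => c * q A) f = c * rint q f.
Proof.
move=> c0 fq bf; have [m [mE i e]] := rint_measure fq bf.
have [n [nE j en]] := rint_measure (fin_measZ c0 fq) bf.
apply: EFin_inj; rewrite EFinM e en.
rewrite (eq_measure_integral (mscale (NngNum c0) m)) => [|A mA _]; last first.
  by rewrite nE // EFinM -mE.
have mf := measurable_int _ i.
(* Scaling of the measure is applied to the positive and negative parts of [f] separately. *)
rewrite integralE [in RHS]integralE !ge0_integral_mscale //; last 2 first.
- exact: measurable_funeneg.
- exact: measurable_funepos.
rewrite -muleBr // fin_num_adde_defl // fin_numN.
exact: integrable_neg_fin_num.
Qed.

Lemma rint0 f : rint (fun=> 0) f = 0.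
Proof.
rewrite /rint (@eq_integral_setfun _ (@mzero _ T R)) //.
by rewrite integral_measure_zero.
Qed.

Lemma rint_sum (I : Type) (r : seq I) (P : pred I) (q : I -> set T -> R) f :
  (forall i, P i -> fin_meas (q i)) -> bounded_measurable f ->
  rint (fun A => \sum_(i <- r | P i) q i A) f =
  \sum_(i <- r | P i) rint (q i) f.
Proof.
move=> fq bf; elim: r => [|i r IH].
  by rewrite big_nil -[RHS](rint0 f); apply: eq_rint => A _; rewrite big_nil.
rewrite big_cons; case: ifPn => Pi; last first.
  by rewrite -IH; apply: eq_rint => A _; rewrite big_cons (negPf Pi).
rewrite -IH -rintD //; [|exact: fq|exact: fin_meas_sum].
by apply: eq_rint => A _; rewrite big_cons Pi.
Qed.

(* Separate the positive and the negative coefficients: both sides are then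
   nonnegative combinations of measures. *)
Lemma rint_lincomb (I : finType) (c : I -> R) (q : I -> set T -> R) f :
  (forall i, fin_meas (q i)) -> bounded_measurable f ->
  (forall A, measurable A -> \sum_i c i * q i A = 0) ->
  \sum_i c i * rint (q i) f = 0.
Proof.
move=> fq bf cq0.
pose cp i := Num.max (c i) 0; pose cn i := Num.max (- c i) 0.
have cp0 i : 0 <= cp i by rewrite le_max lexx orbT.
have cn0 i : 0 <= cn i by rewrite le_max lexx orbT.
have cE i : c i = cp i - cn i.
  rewrite /cp /cn; case: (leP (c i) 0) => ci.
    by rewrite max_l ?oppr_ge0 // opprK add0r.
  by rewrite max_r ?oppr_le0 ?ltW // subr0.
have combE e : (forall i, 0 <= e i) ->
    \sum_i e i * rint (q i) f = rint (fun A => \sum_i e i * q i A) f.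
  move=> e0; rewrite rint_sum // => [|i _]; last exact: fin_measZ.
  by apply: eq_bigr => i _; rewrite rintZ.
under eq_bigr do rewrite cE mulrBl.
rewrite sumrB !combE //; apply/eqP; rewrite subr_eq0; apply/eqP.
apply: eq_rint => A mA; apply/eqP; rewrite -subr_eq0 -sumrB; apply/eqP.
by rewrite -[RHS](cq0 A mA); apply: eq_bigr => i _; rewrite cE mulrBl.
Qed.

(** The measures are real, so the relation splits into one with the real parts and one with the
    imaginary parts of the coefficients. *)
Lemma rint_complex_lincomb (I : finType) (c : I -> R[i])
    (q : I -> set T -> R) f :
  (forall i, fin_meas (q i)) -> bounded_measurable f ->
  (forall A, measurable A -> \sum_i c i * (q i A)%:C%C = 0) ->
  \sum_i c i * (rint (q i) f)%:C%C = 0.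
Proof.
move=> fq bf cq0.
have ReE (x : I -> R) : complex.Re (\sum_i c i * (x i)%:C%C) =
    \sum_i complex.Re (c i) * x i.
  rewrite raddf_sum; apply: eq_bigr => i _.
  by case: (c i) => a b /=; rewrite mulr0 subr0.
have ImE (x : I -> R) : complex.Im (\sum_i c i * (x i)%:C%C) =
    \sum_i complex.Im (c i) * x i.
  rewrite raddf_sum; apply: eq_bigr => i _.
  by case: (c i) => a b /=; rewrite mulr0 add0r.
apply: complex_eqP.
  by rewrite ReE rint_lincomb // => A mA; rewrite -ReE cq0.
by rewrite ImE rint_lincomb // => A mA; rewrite -ImE cq0.
Qed.

End IntegralAsFunctionOfMeasure.

(** * Borel sets, supports and their separation by open sets *)

Section Supports.
Context (R : realType) (X : ptopologicalType).
Local Notation T := (Borel X).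

Lemma open_Borel (U : set X) : open U -> measurable (U : set T).
Proof. by move=> oU; apply: sub_sigma_algebra. Qed.

Lemma continuous_bounded_measurable (f : X -> R) : compact [set: X] ->
  continuous f -> bounded_measurable (f : T -> R).
Proof.
move=> cX cf; split.
  apply: (measurability _ (RGenOpens.measurableE R)) => _ [_ [a [b ->]] <-].
  rewrite setTI; apply: open_Borel; apply: open_comp => // x _; exact: cf.
have /compact_bounded[M [_ fM]] : compact (f @` [set: X]).
  by apply: continuous_compact => //; exact: continuous_subspaceT.
(* The bound is granted only for numbers strictly above [M]. *)
by exists (M + 1) => x; apply: fM; [rewrite ltrDl|exists x].
Qed.

(** A null open neighbourhood of a point outside the support is wholly outside it. *)
Lemma supp_closed (mu : set T -> 'M[R[i]]_1) : closed (supp mu).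
Proof.
rewrite -[supp mu]setCK; apply: open_closedC; rewrite openE => x /=.
move=> /existsNP[U /not_implyP[oU /not_implyP[Ux /negP]]].
rewrite negbK => /eqP U0.
apply: filterS (open_nbhs_nbhs (conj oU Ux)) => y Uy /(_ U oU Uy).
by rewrite U0 eqxx.
Qed.

(* Inner regularity is not needed: the complement of [U] is compact and
   covered by null open sets. *)
Lemma supp_subset_open (p : set T -> R) (mu : set T -> 'M[R[i]]_1) (U : set X) :
  compact [set: X] -> fin_meas p ->
  (forall V, open V -> mu V 0 0 = 0 -> p V = 0) ->
  open U -> supp mu `<=` U -> p (~` U) = 0.
Proof.
move=> cX fp pmu oU sU.
have cU : compact (~` U).
  by apply: (subclosed_compact _ cX) => //; exact: open_closedC.
pose D := [set V : set X | open V /\ mu V 0 0 = 0].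
have := cU; rewrite compact_cover => /(_ _ D id).
case=> [V [] //|x nUx|F FD cF].
  have : ~ supp mu x by move/sU.
  move=> /existsNP[V /not_implyP[oV /not_implyP[Vx /negP]]].
  by rewrite negbK => /eqP V0; exists V.
have [m mE] := fin_meas_ex fp.
(* Only a finite subcover remains, so finite subadditivity, by induction on the list, suffices. *)
have null (s : seq (set X)) : {in s, forall V, open V /\ mu V 0 0 = 0} ->
    measurable (\big[setU/set0]_(V <- s) V : set T) /\
    m (\big[setU/set0]_(V <- s) V) = 0%E.
  elim: s => [_|V s IH sD]; first by rewrite big_nil measure0.
  have [|mV V0] := IH; first by move=> W Ws; apply: sD; rewrite inE Ws orbT.
  have [oV muV0] := sD V (mem_head _ _).
  rewrite big_cons; split; first by apply: measurableU => //; exact: open_Borel.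
  rewrite measureU0 //; last exact: open_Borel.
  by rewrite mE ?pmu //; exact: open_Borel.
have [|mF F0] := null (finmap.enum_fset F); first by move=> V /FD /set_mem.
apply: EFin_inj; rewrite -mE; last first.
  by rewrite -setTD; apply: measurableD => //; exact: open_Borel.
apply: (subset_measure0 _ _ _ F0) => //.
  by rewrite -setTD; apply: measurableD => //; exact: open_Borel.
by rewrite -bigcup_fset.
Qed.

(** A compact Hausdorff space is normal, so each ordered pair of distinct indices has separating
    open sets [W k l]. [E k] is the intersection of all those chosen around [S k], in either
    position of the pair; then [E k] and [E l] lie in the two disjoint halves of [W k l]. *)
Lemma disjoint_open_supports n (S : 'I_n -> set X) :
  compact [set: X] -> hausdorff_space X -> (forall k, closed (S k)) ->
  (forall k l, k != l -> S k `&` S l = set0) ->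
  exists E : 'I_n -> set X,
    [/\ forall k, open (E k), forall k, S k `<=` E k & trivIset setT E].
Proof.
move=> cX hX cS dS.
have nX : normal_space X by exact: compact_normal.
have sep k l : exists UV : set X * set X, k != l ->
    [/\ open UV.1, open UV.2, S k `<=` UV.1, S l `<=` UV.2 &
       UV.1 `&` UV.2 = set0].
  (* The diagonal pair is a dummy that makes the choice total in [k] and [l]. *)
  case: eqVneq => [_|kl]; first by exists (set0, set0).
  have /(@normal_openP R) := nX => /(_ _ _ (cS k) (cS l) (dS _ _ kl)).
  by move=> [U [V UV]]; exists (U, V).
pose W k l := projT1 (cid (sep k l)).
have WP k l (kl : k != l) := projT2 (cid (sep k l)) kl.
pose E k := \big[setI/setT]_(l < n | k != l) ((W k l).1 `&` (W l k).2).
exists E; split.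
- move=> k; rewrite /E; elim/big_ind : _ => [|A B|l kl]; first exact: openT.
    exact: openI.
  have [oW _ _ _ _] := WP k l kl; rewrite eq_sym in kl.
  by have [_ oW' _ _ _] := WP l k kl; exact: openI.
- move=> k; rewrite /E; elim/big_ind : _ => [//|A B SA SB x Sx|l kl x Sx].
    by split; [exact: SA|exact: SB].
  have [_ _ SW _ _] := WP k l kl; rewrite eq_sym in kl.
  by have [_ _ _ SW' _] := WP l k kl; split; [exact: SW|exact: SW'].
- apply/trivIsetP => k l _ _ kl; rewrite -subset0 => x [].
  have lk : l != k by rewrite eq_sym.
  rewrite /E (bigD1 l) //= [X in _ -> X x -> _](bigD1 k) //=.
  move=> [[Wx _] _] [[_ Wx'] _].
  have [_ _ _ _ W0] := WP k l kl.
  have : ((W k l).1 `&` (W k l).2) x by [].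
  by rewrite W0.
Qed.

End Supports.

(** * Positive matrix measures through their scalar measures [v^* nu v] *)

Section MatrixMeasures.
Context (R : realType) (X : ptopologicalType).
Local Notation T := (Borel X).
Local Notation C := R[i].

Definition pos_mxmeasure d (nu : set T -> 'M[C]_d) : Prop :=
  mxmeasure nu /\ forall A, measurable A -> psdmx (nu A).

(** Real-valued version of [qform]: [sint (qform nu v)] and [rint (qmeas nu v)] agree by
    conversion. *)
Definition qmeas d (nu : set T -> 'M[C]_d) (v : 'cV[C]_d) (A : set T) : R :=
  complex.Re (qf (nu A) v).

Lemma ReM (x y : C) : complex.Re (x * y) =
  complex.Re x * complex.Re y - complex.Im x * complex.Im y.
Proof. by case: x y => [a b] [c e]. Qed.

Lemma ImM (x y : C) : complex.Im (x * y) =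
  complex.Re x * complex.Im y + complex.Im x * complex.Re y.
Proof. by case: x y => [a b] [c e]. Qed.

Lemma cvg_sum (I : finType) (u : I -> nat -> R) (l : I -> R) :
  (forall i, u i @ \oo --> l i) ->
  (fun n => \sum_i u i n) @ \oo --> \sum_i l i.
Proof.
move=> ul; apply: cvg_big => [|i _]; first exact: add_continuous.
exact: ul.
Qed.

(** [qmeas nu v] is a fixed real combination of the real and imaginary parts of the entries of [nu],
    each of which is countably additive. *)
Lemma qmeas_fin_meas d (nu : set T -> 'M[C]_d) v :
  pos_mxmeasure nu -> fin_meas (qmeas nu v).
Proof.
move=> [snu pnu]; split=> [A mA|F mF tF]; first exact/psdmx_ge0/pnu.
pose a i j := (v i 0)^* * v j 0.
have qE A : qmeas nu v A = \sum_i \sum_j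
    (complex.Re (a i j) * complex.Re (nu A i j) -
     complex.Im (a i j) * complex.Im (nu A i j)).
  rewrite /qmeas /qf sformE raddf_sum; apply: eq_bigr => i _.
  by rewrite raddf_sum; apply: eq_bigr => j _; exact: ReM.
rewrite qE.
have -> : (fun n => \sum_(k < n) qmeas nu v (F k)) = (fun n => \sum_i \sum_j
    (complex.Re (a i j) * (\sum_(k < n) complex.Re (nu (F k) i j)) -
     complex.Im (a i j) * (\sum_(k < n) complex.Im (nu (F k) i j)))).
  apply/funext => n; under eq_bigr do rewrite qE.
  rewrite exchange_big; apply: eq_bigr => i _.
  rewrite exchange_big; apply: eq_bigr => j _ /=.
  by rewrite sumrB -!mulr_sumr.
apply: cvg_sum => i; apply: cvg_sum => j.
have [cRe cIm] := snu F mF tF i j.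
by apply: cvgB; apply: cvgMr.
Qed.

Definition mxrestr d (nu : set T -> 'M[C]_d) (E A : set T) := nu (A `&` E).

Lemma pos_mxrestr d (nu : set T -> 'M[C]_d) E :
  measurable E -> pos_mxmeasure nu -> pos_mxmeasure (mxrestr nu E).
Proof.
move=> mE pnu; split=> [F mF tF i j|A mA].
  rewrite /mxrestr setI_bigcupl; apply: pnu.1 => [k|]; first exact: measurableI.
  by under eq_fun do rewrite setIC; exact: trivIset_setIl.
by apply: pnu.2; exact: measurableI.
Qed.

Lemma mxmeasure_comb d n (p : 'I_n -> set T -> R) (L : 'I_n -> 'M[C]_d)
    (nu : set T -> 'M[C]_d) : (forall k, fin_meas (p k)) ->
  (forall A, measurable A -> nu A = \sum_(k < n) (p k A)%:C%C *: L k) ->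
  mxmeasure nu.
Proof.
move=> fp nuE F mF tF i j.
have entry A : measurable A -> nu A i j = \sum_(k < n) (p k A)%:C%C * L k i j.
  by move=> mA; rewrite nuE // summxE; apply: eq_bigr => k _; rewrite mxE.
(* [part] stands for the real or the imaginary part; the weights [p k A] are real and factor out of
   both. *)
have comb (part : C -> R) :
    (forall A, measurable A ->
      part (nu A i j) = \sum_(k < n) part (L k i j) * p k A) ->
    (fun N => \sum_(l < N) part (nu (F l) i j)) @ \oo -->
      part (nu (\bigcup_k F k) i j).
  move=> partE; rewrite partE; last exact: bigcup_measurable.
  have -> : (fun N => \sum_(l < N) part (nu (F l) i j)) =
      (fun N => \sum_(k < n) part (L k i j) * \sum_(l < N) p k (F l)).
    apply/funext => N; under eq_bigr do rewrite partE //.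
    by rewrite exchange_big; apply: eq_bigr => k _ /=; rewrite mulr_sumr.
  by apply: cvg_sum => k; apply: cvgMr; exact: (fp k).2.
split; apply: comb => A mA; rewrite entry // raddf_sum;
  apply: eq_bigr => k _ /=.
  by rewrite ReM /= mul0r subr0 mulrC.
by rewrite ImM /= mul0r addr0 mulrC.
Qed.

Lemma psdmx1 d : psdmx (1%:M : 'M[C]_d).
Proof.
move=> v; rewrite mulmx1 mxE; apply: sumr_ge0 => k _.
by rewrite !mxE mulrC; exact: mul_conjC_ge0.
Qed.

Lemma psdmx_comb d n (c : 'I_n -> R) (L : 'I_n -> 'M[C]_d) :
  (forall k, 0 <= c k) -> (forall k, psdmx (L k)) ->
  psdmx (\sum_(k < n) (c k)%:C%C *: L k).
Proof.
move=> c0 pL v; rewrite -[X in 0 <= X]/(qf _ v) qf_sum; apply: sumr_ge0 => k _.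
by rewrite qfZ mulr_ge0 ?ler0c //; exact: pL.
Qed.

(** An additional index carrying [q0] with coefficient [-1] turns the identity into a vanishing
    combination. *)
Lemma rint_complex_comb (I : finType) (c : I -> C) (q : I -> set T -> R)
    (q0 : set T -> R) f :
  fin_meas q0 -> (forall i, fin_meas (q i)) -> bounded_measurable f ->
  (forall A, measurable A -> (q0 A)%:C%C = \sum_i c i * (q i A)%:C%C) ->
  (rint q0 f)%:C%C = \sum_i c i * (rint (q i) f)%:C%C.
Proof.
move=> fq0 fq bf q0E.
pose q' (i : unit + I) := if i is inr i then q i else q0.
pose c' (i : unit + I) := if i is inr i then c i else -1.
have fq' i : fin_meas (q' i) by case: i => /=.
have H A : measurable A -> \sum_i c' i * (q' i A)%:C%C = 0.
  move=> mA; rewrite big_sumType /= (big_pred1 tt) => [|[]//].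
  by rewrite mulN1r q0E // addNr.
have := rint_complex_lincomb fq' bf H.
rewrite big_sumType /= (big_pred1 tt) => [|[]//].
by rewrite mulN1r addrC => /eqP; rewrite subr_eq0 => /eqP.
Qed.

Lemma qf_mx_int d (nu : set T -> 'M[C]_d) f v :
  pos_mxmeasure nu -> bounded_measurable (f : T -> R) ->
  qf (mx_int nu f) v = (rint (qmeas nu v) f)%:C%C.
Proof.
move=> pnu bf.
pose w (i : 'I_d * ('I_d * 'I_4)) := evec R i.2.1 + 'i ^+ i.2.2 *: evec R i.1.
pose c (i : 'I_d * ('I_d * 'I_4)) : C :=
  (v i.1 0)^* * v i.2.1 0 * (4%:R^-1 * 'i ^+ i.2.2).
have sumE (x : 'I_d * ('I_d * 'I_4) -> C) :
    \sum_i c i * x i = \sum_i \sum_j (v i 0)^* * v j 0 *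
      (4%:R^-1 * \sum_(k < 4) ('i ^+ k * x (i, (j, k)))).
  transitivity (\sum_i \sum_p c (i, p) * x (i, p)).
    by rewrite pair_bigA; apply: eq_bigr => -[].
  apply: eq_bigr => i _.
  transitivity (\sum_j \sum_k c (i, (j, k)) * x (i, (j, k))).
    by rewrite pair_bigA; apply: eq_bigr => -[].
  apply: eq_bigr => j _; rewrite !mulr_sumr; apply: eq_bigr => k _.
  by rewrite /c /= !mulrA.
rewrite (@rint_complex_comb _ c (fun i => qmeas nu (w i))) //.
- by rewrite sumE /qf sformE; under eq_bigr do under eq_bigr do rewrite mxE.
- exact: qmeas_fin_meas.
- by move=> i; exact: qmeas_fin_meas.
- move=> A mA; rewrite sumE -psdmx_qf; last exact: pnu.2.
  rewrite /qf sformE; apply: eq_bigr => i _; apply: eq_bigr => j _.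
  congr (_ * _); rewrite -[LHS]sform_evec sform_polarization; congr (_ * _).
  by apply: eq_bigr => k _; rewrite psdmx_qf //; exact: pnu.2.
Qed.

End MatrixMeasures.

(** * Constrained measures, scalar extremality and the decomposition argument *)

Section ExtremePoints.
Context (R : realType) (X : ptopologicalType) (m : nat) (phi : 'I_m -> X -> R).
Local Notation T := (Borel X).
Local Notation C := R[i].
Context (cX : compact [set: X]) (cphi : forall r, continuous (phi r)).

Let bphi r : bounded_measurable (phi r : T -> R).
Proof. exact: continuous_bounded_measurable. Qed.

(** Serves twice: for the measure of the theorem, and with [d = n = 1] for normalized scalar
    measures. The constraints hold because each [v^* nu v] is a nonnegative combination of the
    [p k]. *)
Lemma mxC_comb d n (p : 'I_n -> set T -> R) (L : 'I_n -> 'M[C]_d)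
    (nu : set T -> 'M[C]_d) :
  (forall k, fin_meas (p k)) -> (forall k, p k setT = 1) ->
  (forall k r, rint (p k) (phi r) = 0) ->
  (forall k, psdmx (L k)) -> \sum_(k < n) L k = 1%:M ->
  (forall A, measurable A -> nu A = \sum_(k < n) (p k A)%:C%C *: L k) ->
  mxC phi nu.
Proof.
move=> fp pT pphi pL sL nuE.
have pnu : pos_mxmeasure nu.
  split=> [|A mA]; first exact: mxmeasure_comb nuE.
  by rewrite nuE //; apply: psdmx_comb => // k; exact: (fp k).1.
split; [exact: pnu.1|exact: pnu.2| |move=> r].
  by rewrite nuE // -sL; apply: eq_bigr => k _; rewrite pT scale1r.
apply: qf_inj => v; rewrite qf_mx_int // qf0.
pose l k := complex.Re (qf (L k) v).
have l0 k : 0 <= l k by exact: psdmx_ge0.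
rewrite (@eq_rint _ _ _ _ (fun A => \sum_k l k * p k A)) => [|A mA].
  rewrite rint_sum // => [|k _]; last exact: fin_measZ.
  by rewrite big1 // => k _; rewrite rintZ // pphi mulr0.
rewrite /qmeas nuE // qf_sum raddf_sum; apply: eq_bigr => k _ /=.
by rewrite qfZ ReM /= mul0r subr0 mulrC.
Qed.

Definition scal (mu : set T -> 'M[C]_1) (A : set T) : R :=
  complex.Re (mu A 0 0).

Lemma scalE mu : scal mu = qmeas mu (evec R 0).
Proof. by apply/funext => A; rewrite /scal /qmeas /qf sform_evec. Qed.

Lemma mxC_scal mu : mxC phi mu ->
  [/\ fin_meas (scal mu), scal mu setT = 1,
      forall r, rint (scal mu) (phi r) = 0 &
      forall A, measurable A -> mu A 0 0 = (scal mu A)%:C%C].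
Proof.
move=> [smu pmu muT muphi]; have pos : pos_mxmeasure mu by [].
split.
- by rewrite scalE; exact: qmeas_fin_meas.
- by rewrite /scal muT mxE.
- move=> r; have := qf_mx_int (evec R 0) pos (bphi r).
  by rewrite muphi qf0 scalE => -[].
- move=> A mA; have := psdmx_qf (evec R 0) (pmu A mA).
  by rewrite {1}/qf sform_evec /scal /qf sform_evec.
Qed.

(** Extremality rescaled to total mass [c]. If [c = 0] then [q1] vanishes by monotonicity; otherwise
    [q1 / c] and [q2 / c] are admissible and average to [mu]. *)
Lemma extreme_scal mu (q1 q2 : set T -> R) (c t : R) :
  extreme_pt (mxC phi) mu -> 0 < t < 1 -> fin_meas q1 -> fin_meas q2 ->
  q1 setT = c -> q2 setT = c ->
  (forall r, rint q1 (phi r) = 0) -> (forall r, rint q2 (phi r) = 0) ->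
  (forall A, measurable A -> c * scal mu A = t * q1 A + (1 - t) * q2 A) ->
  forall A, measurable A -> q1 A = c * scal mu A.
Proof.
move=> [Pmu emu] t01 fq1 fq2 q1T q2T q1phi q2phi muE A mA.
have c0 : 0 <= c by rewrite -q1T fq1.1.
have [c_eq0|cN0] := eqVneq c 0.
  rewrite c_eq0 mul0r; apply/eqP; rewrite eq_le fq1.1 // andbT.
  by rewrite -c_eq0 -q1T; apply: fin_meas_le.
have [_ _ _ scmu] := mxC_scal Pmu.
pose nu (q : set T -> R) A : 'M[C]_1 := (c^-1 * q A)%:C%C%:M.
have Pnu (q : set T -> R) : fin_meas q -> q setT = c ->
    (forall r, rint q (phi r) = 0) -> mxC phi (nu q).
  move=> fq qT qphi.
  apply: (@mxC_comb _ 1 (fun _ A => c^-1 * q A) (fun=> 1%:M)).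
  - by move=> _; apply: fin_measZ; rewrite ?invr_ge0.
  - by move=> _; rewrite qT mulVf.
  - by move=> _ r; rewrite rintZ ?invr_ge0 // qphi mulr0.
  - by move=> _; exact: psdmx1.
  - by rewrite big_ord1.
  - by move=> B mB; rewrite big_ord1 scalemx1.
have nuE B : measurable B -> mu B = t%:C%C *: nu q1 B + (1 - t)%:C%C *: nu q2 B.
  move=> mB; apply/matrixP => i j; rewrite !ord1 scmu // !mxE /= !mulr1n.
  rewrite -!rmorphM -rmorphD; congr (_%:C%C).
  by apply: (mulfI cN0); rewrite muE //; field.
have [nu1A _] :=
  emu _ _ t t01 (Pnu _ fq1 q1T q1phi) (Pnu _ fq2 q2T q2phi) nuE A mA.
have : scal (nu q1) A = scal mu A by rewrite /scal nu1A.
by rewrite /scal /nu mxE eqxx mulr1n /= => <-; rewrite mulVKf.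
Qed.

Section Combination.
Context (N n : nat) (mus : 'I_n -> set T -> 'M[C]_1) (L : 'I_n -> 'M[C]_N).
Context (E : 'I_n -> set T).
Context (emus : forall k, extreme_pt (mxC phi) (mus k)).
Context (mE : forall k, measurable (E k)) (tE : trivIset setT E).
Context (musE : forall k, scal (mus k) (~` E k) = 0).
Context (pL : forall k, psdmx (L k)) (sL : \sum_(k < n) L k = 1%:M).
Context (wL : weakly_indep L).

Let l k (v : 'cV[C]_N) : R := complex.Re (qf (L k) v).

Let fmus k : fin_meas (scal (mus k)).
Proof. by have [] := mxC_scal (emus k).1. Qed.

Let null k A : measurable A -> A `<=` ~` E k -> scal (mus k) A = 0.
Proof.
move=> mA AE; apply/eqP; rewrite eq_le (fmus k).1 // andbT -(musE k).
by apply: fin_meas_le => //; exact: measurableC.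
Qed.

Let musI k j A : measurable A ->
  scal (mus j) (A `&` E k) = if j == k then scal (mus k) A else 0.
Proof.
move=> mA; case: eqVneq => [->|jk].
  (* The one-set family [E k] splits [A] into its parts outside and inside [E k]; the outer part is
     null. *)
  have tEk : trivIset [set: 'I_1] (fun=> E k) by move=> i i'; rewrite !ord1.
  have := fin_meas_bigsetU (fmus k) (fun _ : 'I_1 => mE k) tEk mA.
  rewrite !big_ord1 (_ : scal _ (A `\` _) = 0) ?add0r => [-> //|].
  by apply: null => [|x []//]; exact: measurableD.
apply: null; first exact: measurableI.
by move=> x [_ Ekx] Ejx; move/eqP: jk; apply; apply: tE => //; exists x.
Qed.

Let qf_L k v : qf (L k) v = (l k v)%:C%C.
Proof. exact: psdmx_qf. Qed.

(** * One component [nu] of a convex decomposition, with weight [s] *)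

Section Component.
Context (nu : set T -> 'M[C]_N) (Pnu : mxC phi nu) (s : R) (s_gt0 : 0 < s).
Context (dom : forall v A, measurable A ->
  s * qmeas nu v A <= \sum_k l k v * scal (mus k) A).

Local Notation restr k := (mxrestr nu (E k)).

Let pnu : pos_mxmeasure nu. Proof. by have [] := Pnu. Qed.

Let restr_pos k : pos_mxmeasure (restr k).
Proof. exact: pos_mxrestr. Qed.

(** Domination leaves [nu] no mass outside the union of the [E k], where every [mus k] vanishes. *)
Lemma qmeas_mxrestr_sum v A : measurable A ->
  qmeas nu v A = \sum_k qmeas (restr k) v A.
Proof.
move=> mA; rewrite (fin_meas_bigsetU (qmeas_fin_meas v pnu) mE tE mA).
set B := A `\` _.
have mB : measurable B.
  by apply: measurableD => //; apply: bigsetU_measurable => k _; exact: mE.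
suff -> : qmeas nu v B = 0 by rewrite add0r.
apply/eqP; rewrite eq_le (qmeas_fin_meas v pnu).1 // andbT.
rewrite -(pmulr_rle0 _ s_gt0) (le_trans (dom v mB)) // big1 // => k _.
rewrite null ?mulr0 // => x [_ Ux] Ekx; apply: Ux.
by rewrite (bigD1 k) //=; left.
Qed.

(** Inside [E k] only the [k]-th term of the dominating sum is left, so [qf (L k) w = 0] makes the
    form of [restr k A] vanish at [w]. This is the invariance that [lives_on_qf] asks for. *)
Let qf_mxrestrD k v w A : measurable A -> qf (L k) w = 0 ->
  qf (restr k A) (v + w) = qf (restr k A) v.
Proof.
move=> mA Lw0; apply: psdmx_qfDker; first exact: (restr_pos k).2.
have mAE : measurable (A `&` E k) by exact: measurableI.
rewrite psdmx_qf; last exact: (restr_pos k).2.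
suff : qmeas nu w (A `&` E k) = 0 by rewrite /qmeas /mxrestr => ->.
apply/eqP; rewrite eq_le (qmeas_fin_meas w pnu).1 // andbT.
rewrite -(pmulr_rle0 _ s_gt0) (le_trans (dom w mAE)) // big1 // => j _.
rewrite musI //; case: eqVneq => [->|_]; last by rewrite mulr0.
by rewrite /l Lw0 mul0r.
Qed.

Lemma qmeas_mxrestrT k v : qmeas (restr k) v setT = l k v.
Proof.
(* Weak independence is applied to these differences: each lives on the range of [L k], and they sum
   to [nu setT - 1%:M = 0]. *)
have /(_ k) : forall k, restr k setT - L k = 0; last first.
  by move/eqP; rewrite subr_eq0 => /eqP; rewrite /qmeas /l => ->.
apply: wL => [j|].
  apply: lives_on_qf => // u w Lw0.
  by rewrite !qfB qf_mxrestrD // (psdmx_qfDker u (pL j) Lw0).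
rewrite sumrB sL; apply/eqP; rewrite subr_eq0; apply/eqP.
apply: qf_inj => u; rewrite qf_sum.
have [_ _ <- _] := Pnu; rewrite (psdmx_qf _ (pnu.2 _ measurableT)).
rewrite -/(qmeas nu u _) qmeas_mxrestr_sum // rmorph_sum; apply: eq_bigr => j _.
exact/psdmx_qf/(restr_pos j).2.
Qed.

Lemma rint_mxrestr k v r : rint (qmeas (restr k) v) (phi r) = 0.
Proof.
(* Weak independence again: these integrals live on the ranges of the [L k] and sum to
   [mx_int nu (phi r) = 0]. *)
suff /(_ k) M0 : forall k, mx_int (restr k) (phi r) = 0.
  by have := qf_mx_int v (restr_pos k) (bphi r); rewrite M0 qf0 => -[].
apply: wL => [j|].
  apply: lives_on_qf => // u w Lw0;
  rewrite !(qf_mx_int _ (restr_pos j) (bphi r)).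
  congr (_%:C%C).
  by apply: eq_rint => A mA; rewrite /qmeas qf_mxrestrD.
apply: qf_inj => u; rewrite qf_sum qf0.
under eq_bigr do rewrite (qf_mx_int _ (restr_pos _) (bphi r)).
rewrite -rmorph_sum /= -[RHS](rmorph0 (real_complex R)); congr (_%:C%C).
rewrite -rint_sum => [|j _|]; [|exact: qmeas_fin_meas|exact: bphi].
rewrite (@eq_rint _ _ _ _ (qmeas nu u)) => [|A mA]; last first.
  by rewrite qmeas_mxrestr_sum.
have [_ _ _ nuphi] := Pnu; have := qf_mx_int u pnu (bphi r).
by rewrite nuphi qf0 => -[].
Qed.

End Component.

(** Both components are dominated, with weights [t] and [1 - t], so the results on a single
    component apply to each of them. *)
Lemma comb_extreme_eq (nu nu' : set T -> 'M[C]_N) (t : R) : 0 < t < 1 ->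
  mxC phi nu -> mxC phi nu' ->
  (forall A, measurable A -> \sum_(k < n) (mus k A 0 0) *: L k =
     t%:C%C *: nu A + (1 - t)%:C%C *: nu' A) ->
  forall A, measurable A -> nu A = \sum_(k < n) (mus k A 0 0) *: L k.
Proof.
move=> t01 Pnu Pnu' muE A mA.
have [t0 t1] := andP t01; have t1' : 0 < 1 - t by rewrite subr_gt0.
have muqE v B : measurable B ->
    complex.Re (qf (\sum_(k < n) (mus k B 0 0) *: L k) v) =
    \sum_k l k v * scal (mus k) B.
  move=> mB; rewrite qf_sum raddf_sum; apply: eq_bigr => k _.
  have [_ _ _ ->] := mxC_scal (emus k).1 => //.
  by rewrite qfZ qf_L -rmorphM mulrC.
have qE v B : measurable B ->
    \sum_k l k v * scal (mus k) B = t * qmeas nu v B + (1 - t) * qmeas nu' v B.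
  move=> mB; rewrite -muqE // muE // qfD !qfZ raddfD /= !ReM /=.
  by rewrite !mul0r !subr0.
have q0 (xi : set T -> 'M[C]_N) v B : mxC phi xi -> measurable B ->
    0 <= qmeas xi v B.
  by move=> [_ pxi _ _] mB; exact/psdmx_ge0/pxi.
have fin (xi : set T -> 'M[C]_N) : mxC phi xi -> forall k v,
    fin_meas (qmeas (mxrestr xi (E k)) v).
  by move=> [sxi pxi _ _] k v; apply: qmeas_fin_meas; exact: pos_mxrestr.
have dom v B : measurable B ->
    t * qmeas nu v B <= \sum_k l k v * scal (mus k) B.
  by move=> mB; rewrite qE // lerDl mulr_ge0 ?q0 // ltW.
have dom' v B : measurable B ->
    (1 - t) * qmeas nu' v B <= \sum_k l k v * scal (mus k) B.
  by move=> mB; rewrite qE // lerDr mulr_ge0 ?q0 // ltW.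
have qnuE v : qmeas nu v A = \sum_k l k v * scal (mus k) A.
  rewrite (qmeas_mxrestr_sum Pnu t0 dom) //; apply: eq_bigr => k _.
  (* Scalar extremality of [mus k] is used with mass [c = l k v], the common mass on [E k] of the
     two scalar measures. *)
  apply: (extreme_scal (emus k) t01 (fin _ Pnu k v) (fin _ Pnu' k v)
    (qmeas_mxrestrT Pnu t0 dom k v)
    (qmeas_mxrestrT Pnu' t1' dom' k v) _ _ _ mA) => [r|r|B mB].
  - exact: (rint_mxrestr Pnu t0 dom).
  - exact: (rint_mxrestr Pnu' t1' dom').
  - rewrite -qE; last exact: measurableI.
    rewrite (bigD1 k) //= musI // eqxx big1 ?addr0 // => j jk.
    by rewrite musI // (negPf jk) mulr0.
apply: psdmx_Re_inj => [||v]; first by have [_ + _ _] := Pnu; exact.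
  under eq_bigr do rewrite (let: And4 _ _ _ H := mxC_scal (emus _).1 in H _ mA).
  by apply: psdmx_comb => // k; exact: (fmus k).1.
by rewrite muqE // -qnuE.
Qed.

End Combination.
End ExtremePoints.

Theorem theorem3p12 (R : realType) (X : ptopologicalType) (N m n : nat)
  (phi : 'I_m -> X -> R) (mus : 'I_n -> set (Borel X) -> 'M[R[i]]_1)
  (L : 'I_n -> 'M[R[i]]_N) :
  compact [set: X] -> hausdorff_space X -> (0 < N)%N ->
  (forall r, continuous (phi r)) ->
  (forall k, extreme_pt (@mxC R X 1 m phi) (mus k)) ->
  (forall k l, k != l -> supp (mus k) `&` supp (mus l) = set0) ->
  (forall k, psdmx (L k)) -> \sum_(k < n) L k = 1%:M ->
  weakly_indep L ->
  extreme_pt (@mxC R X N m phi) (fun A => \sum_(k < n) (mus k A 0 0) *: L k).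
Proof.
move=> cX hX _ cphi emus dsupp pL sL wL.
have sc k := mxC_scal cX cphi (emus k).1.
have [E [oE SE tE]] :=
  disjoint_open_supports R cX hX (fun k => @supp_closed R X (mus k)) dsupp.
have mE k : measurable (E k : set (Borel X)) by exact: open_Borel.
have musE k : scal (mus k) (~` E k) = 0.
  have [fs _ _ _] := sc k.
  apply: (supp_subset_open cX fs _ (oE k) (SE k)) => V oV V0.
  by rewrite /scal V0.
have eqmu := comb_extreme_eq cX cphi emus mE tE musE pL sL wL.
split.
  apply: (mxC_comb cX cphi (p := fun k => scal (mus k)) _ _ _ pL sL)
    => [k|k|k r|A mA].
  - by have [] := sc k.
  - by have [] := sc k.
  - by have [] := sc k.
  - by apply: eq_bigr => k _; have [_ _ _ ->] := sc k.
move=> nu1 nu2 t t01 P1 P2 muE A mA; split.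
  exact: (eqmu nu1 nu2 t).
have [t0 t1] := andP t01.
(* The second component follows by exchanging the roles of the two, with weight [1 - t]. *)
apply: (eqmu nu2 nu1 (1 - t)) => // [|B mB].
  by rewrite subr_gt0 t1 ltrBlDr ltrDl.
by rewrite subKr addrC; exact: muE.
Qed.
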